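(* Let $1<p<\infty$ and let $w\in A_p^{\mathcal{D}}$ be a weight on $\mathbb{R}^n$. For all $\Lambda>1$, $$\sup_{\mathcal{S}}\frac{\|\mathcal{A}_{\mathcal{S}}:L^p(w)\to L^p(w)\|}{\Lambda}\le\sup_{a,b}\frac{\|\Pi_a^*\Pi_b:L^p(w)\to L^p(w)\|}{\|a\|_{BMO^{\mathcal{D}}}\|b\|_{BMO^{\mathcal{D}}}},$$ where the supremum on the left is over all sparse collections $\mathcal{S}\subset\mathcal{D}$ with Carleson constant $\Lambda$ and no infinitely increasing chains, and the supremum on the right is over all $a,b\in BMO^{\mathcal{D}}(\mathbb{R}^n)$ with nonzero $BMO^{\mathcal{D}}$ norms.
   Context: $\mathcal{D}$ is a fixed dyadic grid on $\mathbb{R}^n$: a collection of cubes with side lengths $2^k$, $k\in\mathbb{Z}$, such that for each fixed $k$ the cubes of side length $2^k$ partition $\mathbb{R}^n$, and $P\cap Q\in\{P,Q,\emptyset\}$ for all $P,Q\in\mathcal{D}$. $\mathcal{S}\subset\mathcal{D}$ has Carleson constant $\Lambda>1$ (is $\Lambda$-Carleson) if $\sum_{P\in\mathcal{S},P\subset Q}|P|\le\Lambda|Q|$ for all $Q\in\mathcal{D}$; it is sparse if it is $\Lambda$-Carleson for some $\Lambda>1$. $\mathcal{S}$ has an infinitely increasing chain if there are $Q_k\in\mathcal{S}$, $k\in\mathbb{N}$, with $Q_k\subsetneq Q_{k+1}$ for all $k$. Haar functions: for an interval $I$, $h_I^0=|I|^{-1/2}(\mathbf{1}_{I_+}-\mathbf{1}_{I_-})$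 ($I_\pm$ the right/left halves) and $h_I^1=|I|^{-1/2}\mathbf{1}_I$; for $Q=I_1\times\dots\times I_n\in\mathcal{D}$ and $\epsilon\in\{0,1\}^n$, $h_Q^\epsilon(x)=\prod_kh_{I_k}^{\epsilon_k}(x_k)$, cancellative when $\epsilon\not\equiv1$. A weight is a locally integrable, a.e. positive function; $\langle f\rangle_Q=\frac1{|Q|}\int_Qf\,dx$, $(f,g)=\int fg\,dx$; $L^p(w)$ is $L^p$ of the measure $w\,dx$. With $1/p+1/p'=1$, $w'=w^{1-p'}$, $w\in A_p^{\mathcal{D}}$ means $\sup_{Q\in\mathcal{D}}\langle w\rangle_Q\langle w'\rangle_Q^{p-1}<\infty$. $\|b\|_{BMO^{\mathcal{D}}}=\sup_{Q\in\mathcal{D}}\frac1{|Q|}\int_Q|b-\langle b\rangle_Q|\,dx$. $\mathcal{A}_{\mathcal{S}}f=\sum_{Q\in\mathcal{S}}\langle f\rangle_Q\mathbf{1}_Q$ and $\Pi_a^*\Pi_bf=\sum_{Q\in\mathcal{D}}\sum_{\epsilon\not\equiv1}(a,h_Q^\epsilon)(b,h_Q^\epsilon)\langle f\rangle_Q\frac{\mathbf{1}_Q}{|Q|}$, the composition of the paraproducts $\Pi_bf=\sum_{Q,\epsilon\not\equiv1}(b,h_Q^\epsilon)\langle f\rangle_Qh_Q^\epsilon$ and $\Pi_a^*f=\sum_{Q,\epsilon\not\equiv1}(a,h_Q^\epsilon)(f,h_Q^\epsilon)\frac{\mathbf{1}_Q}{|Q|}$. $\|T:X\to Y\|$ is the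 operator norm. *)

(* Defs.v *)
From HB Require Import structures.
From mathcomp Require Import all_boot all_order all_algebra.
From mathcomp Require Import all_classical all_reals all_analysis measurable_realfun.

Set Implicit Arguments.
Unset Strict Implicit.
Unset Printing Implicit Defensive.

Import Order.TTheory GRing.Theory Num.Theory.
Import numFieldNormedType.Exports.

Local Open Scope classical_set_scope.
Local Open Scope ring_scope.

(* R^n is [n.-tuple R], with the product sigma-algebra (the Borel sets).      *)
(* Its Lebesgue measure is built one coordinate at a time: on R^0 it is the   *)
(* unit mass, on R^(n+1) the image of the product of the measures of R and    *)
(* R^n under (x, y) |-> x :: y.                                               *)

Definition tuple_cons (R : realType) (n : nat) (xy : R * n.-tuple R) :
  n.+1.-tuple R := [tuple of xy.1 :: xy.2].

Lemma measurable_tuple_cons (R : realType) (n : nat) :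
  measurable_fun [set: R * n.-tuple R] (@tuple_cons R n).
Proof.
have := @measurable_cons _ _ (R * n.-tuple R)%type R fst n snd.
by apply; [exact: measurable_fst | exact: measurable_snd].
Qed.

Section lebesgue_step.
Context (R : realType) (n : nat).
Variable nu : {sigma_finite_measure set (n.-tuple R) -> \bar R}.
Local Open Scope ereal_scope.

Definition lebesgue_step : set (n.+1.-tuple R) -> \bar R :=
  pushforward ((@lebesgue_measure R) \x nu) (@tuple_cons R n).

Let measurable_preimage A :
  measurable A -> measurable (@tuple_cons R n @^-1` A).
Proof.
by move=> mA; rewrite -[X in measurable X]setTI; exact: measurable_tuple_cons.
Qed.

Let lebesgue_step0 : lebesgue_step set0 = 0.
Proof. by rewrite /lebesgue_step /pushforward preimage_set0 measure0. Qed.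

Let lebesgue_step_ge0 A : 0 <= lebesgue_step A.
Proof. by rewrite /lebesgue_step /pushforward; apply: measure_ge0. Qed.

Let lebesgue_step_sigma_additive : semi_sigma_additive lebesgue_step.
Proof.
move=> F mF tF mUF; rewrite /lebesgue_step /pushforward preimage_bigcup.
apply: measure_semi_sigma_additive.
- by move=> k; exact: measurable_preimage.
- apply/trivIsetP => /= i j _ _ ij; rewrite -preimage_setI.
  by move/trivIsetP : tF => /(_ _ _ _ _ ij) ->//; rewrite preimage_set0.
- by rewrite -preimage_bigcup; exact: measurable_preimage.
Qed.

HB.instance Definition _ := isMeasure.Build _ _ _ lebesgue_step
  lebesgue_step0 lebesgue_step_ge0 lebesgue_step_sigma_additive.

Let lebesgue_step_sigma_finite : sigma_finite setT lebesgue_step.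
Proof.
have /sigma_finiteP[F [TF ndF Foo]] := sigma_finiteT (@lebesgue_measure R).
have /sigma_finiteP[G [TG ndG Goo]] := sigma_finiteT nu.
pose uncons (t : n.+1.-tuple R) : R * n.-tuple R := (thead t, [tuple of behead t]).
have consK : cancel (@tuple_cons R n) uncons.
  move=> [x y]; rewrite /uncons /tuple_cons /=.
  by congr pair; exact/val_inj.
have muncons : measurable_fun setT uncons.
  apply: measurable_fun_pair; first exact: measurable_tnth.
  exact: measurable_behead.
exists (fun k => uncons @^-1` (F k `*` G k)).
  rewrite -preimage_bigcup (_ : \bigcup_k _ = setT) ?preimage_setT//.
  rewrite -subTset => -[x y] _.
  have [i _ Fix] : (\bigcup_i F i) x by rewrite -TF.
  have [j _ Gjy] : (\bigcup_i G i) y by rewrite -TG.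
  exists (maxn i j) => //; split => /=.
  - by move: x Fix; exact/subsetPset/ndF/leq_maxl.
  - by move: y Gjy; exact/subsetPset/ndG/leq_maxr.
move=> k; have [mF Fk] := Foo k; have [mG Gk] := Goo k; split.
  by rewrite -[X in measurable X]setTI; apply: muncons => //; exact: measurableX.
rewrite /lebesgue_step /pushforward -comp_preimage.
rewrite (_ : uncons \o _ = id); last by apply/funext => z /=; rewrite consK.
by rewrite preimage_id product_measure1E// lte_mul_pinfty// ge0_fin_numE.
Qed.

HB.instance Definition _ := @Measure_isSigmaFinite.Build _ _ _ lebesgue_step
  lebesgue_step_sigma_finite.

End lebesgue_step.

Fixpoint lebesgue_tuple (R : realType) (n : nat) :
    {sigma_finite_measure set (n.-tuple R) -> \bar R} :=
  match n with
  | 0 => \d_([tuple] : 0.-tuple R)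
  | m.+1 => lebesgue_step (lebesgue_tuple R m)
  end.

(* A cube is encoded by the pair (k, c) of its scale and its lower corner: it *)
(* is the half-open cube prod_i [c_i, c_i + 2^k[. For 0 < n distinct pairs    *)
(* denote distinct subsets of R^n.                                            *)
Definition cube (R : realType) (n : nat) : Type := (int * n.-tuple R)%type.

Section cubes.
Context (R : realType) (n : nat).
Implicit Types (P Q : cube R n) (D S : set (cube R n)).
Local Open Scope ereal_scope.

Local Notation leb := (lebesgue_tuple R n).

Definition cube_scale Q : int := Q.1.
Definition side_length Q : R := (2%:R ^ cube_scale Q)%R.
Definition cube_lo Q (i : 'I_n) : R := tnth Q.2 i.
Definition cube_hi Q (i : 'I_n) : R := (tnth Q.2 i + side_length Q)%R.

Definition cube_set Q : set (n.-tuple R) :=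
  [set x | forall i, tnth x i \in `[cube_lo Q i, cube_hi Q i[%R].

Definition dyadic_grid D : Prop :=
  (forall k : int,
     classical_sets.partition [set Q | D Q /\ cube_scale Q = k]
       cube_set [set: n.-tuple R])
  /\ (forall P Q, D P -> D Q ->
        [\/ cube_set P `&` cube_set Q = cube_set P,
            cube_set P `&` cube_set Q = cube_set Q
          | cube_set P `&` cube_set Q = set0]).

Definition carleson D (L : R) S : Prop :=
  forall Q, D Q ->
    \esum_(P in [set P | S P /\ cube_set P `<=` cube_set Q]) leb (cube_set P)
      <= L%:E * leb (cube_set Q).

Definition has_infinite_increasing_chain S : Prop :=
  exists Q : nat -> cube R n,
    forall k, S (Q k) /\ cube_set (Q k) `<` cube_set (Q k.+1).

Definition haar1 (e : bool) (l r t : R) : R :=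
  ((Num.sqrt (r - l))^-1 *
   if e then \1_(`[l, r[%classic) t
   else \1_(`[((l + r) / 2)%R, r[%classic) t
        - \1_(`[l, ((l + r) / 2)%R[%classic) t)%R.

Definition haar Q (e : {ffun 'I_n -> bool}) (x : n.-tuple R) : R :=
  (\prod_(i < n) haar1 (e i) (cube_lo Q i) (cube_hi Q i) (tnth x i))%R.

Definition cancellative (e : {ffun 'I_n -> bool}) : bool :=
  e != [ffun => true].

(* Extended-valued, so that the average of a nonnegative function that is not *)
(* integrable is +oo.                                                         *)
Definition avg (f : n.-tuple R -> R) Q : \bar R :=
  (\int[leb]_(x in cube_set Q) (f x)%:E) / leb (cube_set Q).

Definition pairing (f g : n.-tuple R -> R) : R :=
  (\int[leb]_(x in [set: n.-tuple R]) (f x * g x))%R.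

(* Unconditional sum of a real family; it is infinite when the family is not  *)
(* summable.                                                                  *)
Definition signed_sum D (g : cube R n -> R) : \bar R :=
  \esum_(Q in D) (EFin \o g)^\+ Q - \esum_(Q in D) (EFin \o g)^\- Q.

Definition sparse_operator S (f : n.-tuple R -> R) (x : n.-tuple R) : \bar R :=
  signed_sum S (fun Q => (fine (avg f Q) * \1_(cube_set Q) x)%R).

Definition paraproduct_composition D (a b f : n.-tuple R -> R)
    (x : n.-tuple R) : \bar R :=
  signed_sum D (fun Q =>
    \sum_(e : {ffun 'I_n -> bool} | cancellative e)
      pairing a (haar Q e) * pairing b (haar Q e) * fine (avg f Q)
        * (\1_(cube_set Q) x / fine (leb (cube_set Q))))%R.

Definition locally_integrable_tuple (f : n.-tuple R -> R) : Prop :=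
  measurable_fun [set: n.-tuple R] f /\
  forall r : R,
    leb.-integrable [set x | forall i, `|tnth x i| <= r]%R (EFin \o f).

Definition bmo_norm D (b : n.-tuple R -> R) : \bar R :=
  ereal_sup [set avg (fun x => `|b x - fine (avg b Q)|%R) Q | Q in D].

Definition bmo D (b : n.-tuple R -> R) : Prop :=
  locally_integrable_tuple b /\ bmo_norm D b < +oo.

Record weight := Weight {
  weight_fun :> n.-tuple R -> R;
  weight_locally_integrable : locally_integrable_tuple weight_fun;
  weight_gt0 : {ae leb, forall x, (0 < weight_fun x)%R} }.

(* With p' = p / (p - 1), i.e. 1/p + 1/p' = 1. *)
Definition dual_weight (p : R) (w : n.-tuple R -> R) (x : n.-tuple R) : R :=
  (w x `^ (1 - p / (p - 1)))%R.

Definition Ap D (p : R) (w : n.-tuple R -> R) : Prop :=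
  ereal_sup [set avg w Q * (avg (dual_weight p w) Q) `^ (p - 1) | Q in D] < +oo.

(* The measure w dx. Since w > 0 almost everywhere, replacing w by its        *)
(* positive part does not change the integrals; it makes the set function     *)
(* nonnegative by construction.                                               *)
Definition weighted_measure (w : weight) (A : set (n.-tuple R)) : \bar R :=
  \int[leb]_(x in A) ((w^\+)%R x)%:E.

Section weighted_measure_instance.
Variable w : weight.

Let weighted_measure0 : weighted_measure w set0 = 0.
Proof. exact: integral_set0. Qed.

Let weighted_measure_ge0 A : 0 <= weighted_measure w A.
Proof. by apply: integral_ge0 => x _; rewrite lee_fin; exact: funrpos_ge0. Qed.

Let weighted_measure_sigma_additive : semi_sigma_additive (weighted_measure w).
Proof.
apply: semi_sigma_additive_nng_induced.
- apply/measurable_EFinP.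
  apply: measurable_funrpos.
  by have [] := weight_locally_integrable w.
- by move=> x; rewrite lee_fin; exact: funrpos_ge0.
Qed.

HB.instance Definition _ := isMeasure.Build _ _ _ (weighted_measure w)
  weighted_measure0 weighted_measure_ge0 weighted_measure_sigma_additive.

End weighted_measure_instance.

Definition weighted_opnorm (p : R) (w : weight)
    (T : (n.-tuple R -> R) -> n.-tuple R -> \bar R) : \bar R :=
  ereal_sup [set 'N[weighted_measure w]_(p%:E)[T f] | f in
    [set f : n.-tuple R -> R | f \in Lfun (weighted_measure w) p%:E /\
      'N[weighted_measure w]_(p%:E)[EFin \o f] <= 1]].

End cubes.

(* Main.v *)
Require Import Defs.
From mathcomp Require Import all_boot all_order all_algebra.
From mathcomp Require Import all_classical all_reals all_analysis measurable_realfun.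
From mathcomp Require Import ring lra.

Set Implicit Arguments.
Unset Strict Implicit.
Unset Printing Implicit Defensive.

Import Order.TTheory GRing.Theory Num.Theory.
Import numFieldNormedType.Exports.

Local Open Scope classical_set_scope.
Local Open Scope ring_scope.

(** Fix one cancellative sign pattern e0 and put
      b = sum over P in S of |P|^(1/2) h_P^e0.
    The Haar functions are orthonormal, so (b, h_Q^e) equals |Q|^(1/2) when
    Q is in S and e = e0, and 0 for the other cancellative e; hence
    Pi_b^* Pi_b f = sum over Q in S of |Q| <f>_Q 1_Q / |Q| = A_S f, exactly and
    pointwise [paraproduct_haar_sum].  On a cube Q of the grid, b minus its
    average is the sum F of the terms with P inside Q, whose square has integral
    the total volume of these P, at most L |Q| by the Carleson condition.  Since
    2 sqrt L |F| <= F^2 + L, the mean oscillation of b is at most sqrt L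
    [oscillation_haar_sum_le]; it is at least 1 on the cubes of S, by testing
    against the Haar function of Q [oscillation_haar_sum_ge1].  So
    1 <= ||b||^2 <= L for nonempty S, and the quotient of b with itself on the right-hand side
    dominates ||A_S|| / L [sparse_opnorm_finite].

    This argument is run for finite S only, so that b is a finite sum of bounded
    functions with bounded support.  The general case follows because
    |A_S f| <= A_S |f| and A_S |f| is the increasing limit of A_T |f| along
    finite subfamilies T that exhaust S, which is countable since the grid is;
    monotone convergence passes the bound to the limit
    [weighted_opnorm_sparse_le].

    All the integrals are computed from those of products of functions of one
    variable [has_integral_prod], and the orthogonality of Haar functions comes
    from one geometric fact: in every coordinate, a cube of the grid strictly
    contained in another one lies in one of the two halves of the larger
    [grid_strictly_inside], where the larger Haar function is constant. *)

(** * Integrals of products of functions of one variable *)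

Section has_integral.
Context d (T : measurableType d) (R : realType) (mu : {measure set T -> \bar R}).
Implicit Types (f g : T -> R) (v : R).

(** Integrability and value are carried together so that linear combinations
    need no separate side conditions. *)
Definition has_integral f v : Prop :=
  mu.-integrable setT (EFin \o f) /\ (\int[mu]_x (f x)%:E)%E = v%:E.

Lemma has_integral0 : has_integral (fun=> 0) 0.
Proof. by split; [exact: integrable0 | rewrite integral0]. Qed.

Lemma has_integralD f g u v : has_integral f u -> has_integral g v ->
  has_integral (fun x => f x + g x) (u + v).
Proof.
move=> [fi fu] [gi gv]; split.
  by have := integrableD measurableT fi gi.
by under eq_integral do rewrite EFinD; rewrite integralD// fu gv.
Qed.

Lemma has_integralZ f v c : has_integral f v ->
  has_integral (fun x => c * f x) (c * v).
Proof.
move=> [fi fv]; split; first by have := integrableZl measurableT c fi.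
by under eq_integral do rewrite EFinM; rewrite integralZl// fv.
Qed.

Lemma has_integral_sum (I : eqType) (s : seq I) (f : I -> T -> R) (v : I -> R) :
  (forall i, i \in s -> has_integral (f i) (v i)) ->
  has_integral (fun x => \sum_(i <- s) f i x) (\sum_(i <- s) v i).
Proof.
elim: s => [|i s IH] fv.
  rewrite big_nil; under eq_fun do rewrite big_nil; exact: has_integral0.
rewrite big_cons; under eq_fun do rewrite big_cons.
apply: has_integralD; first by apply: fv; rewrite mem_head.
by apply: IH => j js; apply: fv; rewrite inE js orbT.
Qed.

End has_integral.

Lemma eq_has_integral d (T : measurableType d) (R : realType)
    (mu nu : {measure set T -> \bar R}) (f : T -> R) v :
  (forall A, measurable A -> mu A = nu A) ->
  has_integral mu f v -> has_integral nu f v.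
Proof.
move=> mn [/integrableP[mf fi] fv].
have eqi g : (\int[nu]_x g x = \int[mu]_x g x)%E.
  by apply: eq_measure_integral => A mA _; rewrite mn.
by split; [apply/integrableP; split=> //|]; rewrite eqi.
Qed.

Lemma has_integral_prod2 d d' (T : measurableType d) (T' : measurableType d')
    (R : realType) (mu : {sigma_finite_measure set T -> \bar R})
    (nu : {sigma_finite_measure set T' -> \bar R}) f g u v :
  has_integral mu f u -> has_integral nu g v ->
  has_integral (mu \x nu)%E (fun xy => f xy.1 * g xy.2) (u * v).
Proof.
move=> [fi fu] [gi gv].
have mf : measurable_fun setT f by apply/measurable_EFinP; exact: measurable_int fi.
have mg : measurable_fun setT g by apply/measurable_EFinP; exact: measurable_int gi.
have mfg : measurable_fun setT (fun xy : T * T' => f xy.1 * g xy.2).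
  by apply: measurable_funM; exact: measurableT_comp.
have ifg : (mu \x nu)%E.-integrable setT (EFin \o (fun xy => f xy.1 * g xy.2)).
  apply/integrable12ltyP; first exact/measurable_EFinP.
  under eq_integral => x _.
    under eq_integral => y _ do rewrite /= normrM EFinM.
    rewrite ge0_integralZl//; last first.
      by do 2 apply: measurableT_comp => //.
    over.
  rewrite ge0_integralZr//; [|by do 2 apply: measurableT_comp => //|exact: integral_ge0].
  have /integrableP[_ fi'] := fi; have /integrableP[_ gi'] := gi.
  by rewrite lte_mul_pinfty// ?integral_ge0// ge0_fin_numE// integral_ge0.
split=> //.
rewrite -[LHS](@integral12_prod_meas1 _ _ _ _ _ mu nu (fun xy => (f xy.1 * g xy.2)%:E))//.
rewrite /fubini_F.
under eq_integral => x _.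
  under eq_integral => y _ do rewrite /= EFinM.
  rewrite integralZl// gv -EFinM mulrC EFinM.
  over.
by rewrite integralZl// fu -EFinM mulrC.
Qed.

(** Induction on the dimension: the Lebesgue measure on tuples of length n + 1 is
    the image of a product measure under consing, and Fubini splits off the first
    factor. *)
Lemma has_integral_prod (R : realType) n (f : 'I_n -> R -> R) (v : 'I_n -> R) :
  (forall i, has_integral lebesgue_measure (f i) (v i)) ->
  has_integral (lebesgue_tuple R n) (fun x => \prod_(i < n) f i (tnth x i))
    (\prod_(i < n) v i).
Proof.
elim: n f v => [|n IH] f v fv.
  rewrite big_ord0 (_ : (fun _ => _) = cst (1 : R)); last first.
    by apply/funext => x; rewrite big_ord0.
  have m1 : measurable_fun [set: 0.-tuple R] (EFin \o cst (1 : R)).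
    by apply/measurable_EFinP; exact: measurable_cst.
  split; last by rewrite /= integral_dirac// diracT mul1e.
  apply/integrableP; split => //.
  rewrite integral_dirac //; last exact: measurableT_comp.
  by rewrite diracT mul1e /= normr1 ltry.
have [gi gv] := has_integral_prod2 (fv ord0) (IH _ _ (fun i => fv (lift ord0 i))).
have mf i : measurable_fun setT (f i).
  by apply/measurable_EFinP; exact: measurable_int (fv i).1.
have mF : measurable_fun setT
    (EFin \o (fun x : n.+1.-tuple R => \prod_(i < n.+1) f i (tnth x i))).
  apply/measurable_EFinP; apply: measurable_prod => i _.
  apply: measurableT_comp => //; exact: measurable_tnth.
have FE (xy : R * n.-tuple R) : \prod_(i < n.+1) f i (tnth (tuple_cons xy) i) =
    f ord0 xy.1 * \prod_(i < n) f (lift ord0 i) (tnth xy.2 i).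
  rewrite big_ord_recl; congr (_ * _).
  by apply: eq_bigr => i _; rewrite tnthS.
have iF : (lebesgue_measure \x lebesgue_tuple R n)%E.-integrable
    (@tuple_cons R n @^-1` setT)
    ((EFin \o (fun x : n.+1.-tuple R => \prod_(i < n.+1) f i (tnth x i)))
      \o @tuple_cons R n).
  rewrite preimage_setT; apply: eq_integrable gi => // xy _.
  by rewrite /= FE.
(* The measure in dimension n + 1 and the pushforward are the same set function
   under two different measure structures. *)
apply: (@eq_has_integral _ _ _
    (pushforward (lebesgue_measure \x lebesgue_tuple R n)%E (@tuple_cons R n))) => [|//|mc].
  exact: measurable_tuple_cons.
split.
  exact: (integrable_pushforward mc mF iF measurableT).
rewrite [LHS](integral_pushforward mc mF iF measurableT).
rewrite preimage_setT big_ord_recl -gv; apply: eq_integral => xy _.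
by rewrite /= FE.
Qed.

(** * Unnormalised Haar functions *)

Section interval_sign.
Context (R : realType).
Implicit Types (e : bool) (l r t : R).

(** The one-dimensional Haar function without its factor |I|^(-1/2); its values
    are 1, -1 and 0, so that products of two of them on the same interval stay in
    the family. *)
Definition interval_sign e l r t : R :=
  if e then \1_(`[l, r[%classic) t
  else \1_(`[((l + r) / 2)%R, r[%classic) t - \1_(`[l, ((l + r) / 2)%R[%classic) t.

Lemma haar1E e l r t : haar1 e l r t = (Num.sqrt (r - l))^-1 * interval_sign e l r t.
Proof. by []. Qed.

Lemma indic_itvcoE l r t : \1_(`[l, r[%classic) t = (l <= t < r)%R%:R :> R.
Proof. by rewrite indicE; congr ((nat_of_bool _)%:R); rewrite mem_setE in_itv. Qed.

Lemma interval_signE e l r t : l < r ->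
  interval_sign e l r t =
    if l <= t < r then (if e || ((l + r) / 2 <= t) then 1 else -1) else 0.
Proof.
move=> lr; rewrite /interval_sign !indic_itvcoE.
have l_m : l < (l + r) / 2 by lra.
have m_r : (l + r) / 2 < r by lra.
case: e => /=; first by case: ifP.
have [mt|tm] := leP ((l + r) / 2) t.
  rewrite andbF subr0 (ltW (lt_le_trans l_m mt)) /=.
  by case: ifP.
by rewrite (lt_trans tm m_r) !andbT; case: (l <= t); rewrite ?sub0r ?oppr0.
Qed.

Lemma interval_signM e e' l r t : l < r ->
  interval_sign e l r t * interval_sign e' l r t = interval_sign (e == e') l r t.
Proof.
move=> lr; rewrite !interval_signE//.
case: ifP => _; last by rewrite mul0r.
by case: e e' => -[]; case: leP => _ /=; ring.
Qed.

Lemma has_integral_indic_itvco l r : l <= r ->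
  has_integral lebesgue_measure (\1_(`[l, r[%classic) : R -> R) (r - l).
Proof.
move=> lr; have leb_itv : lebesgue_measure `[l, r[%classic = (r - l)%:E.
  rewrite lebesgue_measure_itv/= lte_fin.
  by case: ltgtP lr => // -> _; rewrite subrr.
split; last by rewrite integral_indic// setIT.
exact: integrable_indic_itv.
Qed.

Lemma has_integral_interval_sign e l r : l < r ->
  has_integral lebesgue_measure (interval_sign e l r) (if e then r - l else 0).
Proof.
move=> lr; rewrite /interval_sign; case: e; first exact/has_integral_indic_itvco/ltW.
have l_m : l <= (l + r) / 2 by lra.
have m_r : (l + r) / 2 <= r by lra.
have := has_integralD (has_integral_indic_itvco m_r)
  (has_integralZ (-1) (has_integral_indic_itvco l_m)).
rewrite (_ : r - (l + r) / 2 + -1 * ((l + r) / 2 - l) = 0); last by lra.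
by under eq_fun do rewrite mulN1r.
Qed.

Definition in_half (l r l' r' : R) : Prop :=
  (l' <= l /\ r <= (l' + r') / 2) \/ ((l' + r') / 2 <= l /\ r <= r').

Lemma interval_sign_in_half e l r l' r' t t' : l' < r' -> in_half l r l' r' ->
  l <= t < r -> l <= t' < r ->
  interval_sign e l' r' t = interval_sign e l' r' t'.
Proof.
move=> lr; rewrite /in_half => half /andP[lt tr] /andP[lt' tr'].
rewrite !interval_signE//.
have l_m : l' < (l' + r') / 2 by lra.
have m_r : (l' + r') / 2 < r' by lra.
move: ((l' + r') / 2) half l_m m_r => m half l_m m_r.
case: half => -[h1 h2].
  have tm : t < m by exact: lt_le_trans tr h2.
  have tm' : t' < m by exact: lt_le_trans tr' h2.

  have -> : (m <= t) = false by apply/negbTE; rewrite -ltNge.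
  have -> : (m <= t') = false by apply/negbTE; rewrite -ltNge.
  have -> : (l' <= t < r') by apply/andP; split; lra.
  by have -> : (l' <= t' < r') by apply/andP; split; lra.
have [? ?] : m <= t /\ m <= t' by split; lra.
have -> : (m <= t) by [].
have -> : (m <= t') by [].
have -> : (l' <= t < r') by apply/andP; split; lra.
by have -> : (l' <= t' < r') by apply/andP; split; lra.
Qed.

End interval_sign.

Section haar_sign.
Context (R : realType) (n : nat).
Implicit Types (P Q : cube R n) (e : {ffun 'I_n -> bool}) (x y : n.-tuple R).
Local Notation leb := (lebesgue_tuple R n).

Definition volume Q : R := side_length Q ^+ n.

Lemma side_length_gt0 Q : 0 < side_length Q.
Proof. by rewrite /side_length exprz_gt0. Qed.

Lemma volume_gt0 Q : 0 < volume Q.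
Proof. by rewrite exprn_gt0// side_length_gt0. Qed.

Lemma cube_lo_lt_hi Q i : cube_lo Q i < cube_hi Q i.
Proof. by rewrite /cube_hi /cube_lo ltrDl side_length_gt0. Qed.

Lemma cube_hiBlo Q i : cube_hi Q i - cube_lo Q i = side_length Q.
Proof. by rewrite /cube_hi /cube_lo addrAC subrr add0r. Qed.

Lemma cube_setP Q x :
  cube_set Q x <-> forall i, cube_lo Q i <= tnth x i < cube_hi Q i.
Proof. by split => h i; have := h i; rewrite in_itv. Qed.

(** The n-dimensional Haar function multiplied by |Q|^(1/2). *)
Definition haar_sign Q e x : R :=
  \prod_(i < n) interval_sign (e i) (cube_lo Q i) (cube_hi Q i) (tnth x i).

Lemma haarE Q e x :
  haar Q e x = (Num.sqrt (side_length Q) ^+ n)^-1 * haar_sign Q e x.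
Proof.
rewrite /haar; under eq_bigr do rewrite haar1E cube_hiBlo.
by rewrite big_split/= prodr_const card_ord exprVn.
Qed.

Lemma haar_sign_notin Q e x : ~ cube_set Q x -> haar_sign Q e x = 0.
Proof.
move=> /cube_setP/existsNP[i /negP xi]; rewrite /haar_sign (bigD1 i)//=.
by rewrite interval_signE ?cube_lo_lt_hi// (negbTE xi) mul0r.
Qed.

(** The multiplication is that of signs coordinate by coordinate; with
    [has_integral_haar_sign] it gives the orthogonality of the Haar functions of a
    single cube. *)
Lemma haar_signM Q e e' x : haar_sign Q e x * haar_sign Q e' x =
  haar_sign Q [ffun i => e i == e' i] x.
Proof.
rewrite /haar_sign -big_split/=; apply: eq_bigr => i _.
by rewrite ffunE interval_signM// cube_lo_lt_hi.
Qed.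

Lemma haar_sign_true Q x : haar_sign Q [ffun=> true] x = \1_(cube_set Q) x.
Proof.
have [Qx|Qx] := pselect (cube_set Q x); last first.
  by rewrite haar_sign_notin// indicE memNset.
rewrite indicE mem_set// /haar_sign big1// => i _.
by rewrite ffunE interval_signE ?cube_lo_lt_hi//= (cube_setP Q x).1.
Qed.

Lemma haar_sign_sqr Q e x : haar_sign Q e x * haar_sign Q e x = \1_(cube_set Q) x.
Proof.
rewrite haar_signM -haar_sign_true; congr haar_sign.
by apply/ffunP => i; rewrite !ffunE eqxx.
Qed.

Lemma haar_sign_le1 Q e x : `|haar_sign Q e x| <= 1.
Proof.
have [Qx|Qx] := pselect (cube_set Q x); last by rewrite haar_sign_notin// normr0.
rewrite -(@ler_pXn2r _ 2)// ?nnegrE// expr1n real_normK ?num_real// expr2.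
by rewrite haar_sign_sqr indicE mem_set.
Qed.

(** A cancellative pattern has a coordinate in which the factor integrates to 0. *)
Lemma has_integral_haar_sign Q e :
  has_integral leb (haar_sign Q e) (if cancellative e then 0 else volume Q).
Proof.
have -> : (if cancellative e then 0 else volume Q) =
    \prod_(i < n) (if e i then cube_hi Q i - cube_lo Q i else 0).
  rewrite /cancellative; case: eqP => /= [->|ne].
    by under eq_bigr do rewrite ffunE cube_hiBlo; rewrite prodr_const card_ord.
  have [i ei] : exists i, ~~ e i.
    apply/not_existsP => h; apply: ne; apply/ffunP => i; rewrite ffunE.
    by have /negP := h i; rewrite negbK.
  by rewrite (bigD1 i)//= (negbTE ei) mul0r.
apply: (@has_integral_prod _ _ (fun i => interval_sign (e i) (cube_lo Q i) (cube_hi Q i))) => i.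
exact/has_integral_interval_sign/cube_lo_lt_hi.
Qed.

Lemma measurable_cube_set Q : measurable (cube_set Q).
Proof.
rewrite (_ : cube_set Q =
    haar_sign Q [ffun=> true] @^-1` [set 1]); last first.
  apply/seteqP; split=> x /=; rewrite haar_sign_true indicE.
    by move=> Qx; rewrite mem_set.
  have [//|Qx] := pselect (cube_set Q x).
  by rewrite memNset//= => /esym/eqP; rewrite oner_eq0.
rewrite -[X in measurable X]setTI.
have [/measurable_int/measurable_EFinP mQ _] := has_integral_haar_sign Q [ffun=> true].
exact: (mQ measurableT _ (measurable_set1 1)).
Qed.

Lemma leb_cube_set Q : leb (cube_set Q) = (volume Q)%:E.
Proof.
have [_] := has_integral_haar_sign Q [ffun=> true].
rewrite /cancellative eqxx/=; under eq_integral do rewrite haar_sign_true.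
by rewrite integral_indic ?setIT//; exact: measurable_cube_set.
Qed.

End haar_sign.

(** * Geometry of a dyadic grid *)

Section cube_geometry.
Context (R : realType) (n : nat).
Implicit Types (P Q C : cube R n) (x : n.-tuple R) (i : 'I_n).

(** Stronger than strict inclusion for arbitrary cubes, but equivalent to it in a
    grid, as [grid_strictly_inside] shows; it makes the Haar functions of Q
    constant on P. *)
Definition strictly_inside P Q : Prop :=
  forall i, in_half (cube_lo P i) (cube_hi P i) (cube_lo Q i) (cube_hi Q i).

Lemma cube_corner Q : cube_set Q Q.2.
Proof. by apply/cube_setP => i; rewrite lexx cube_lo_lt_hi. Qed.

(** Moving one coordinate of a point reduces statements on cubes to statements on
    their sides. *)
Definition update x i (t : R) : n.-tuple R :=
  [tuple if j == i then t else tnth x j | j < n].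

Lemma cube_set_update Q x i t :
  cube_set Q x -> cube_lo Q i <= t < cube_hi Q i -> cube_set Q (update x i t).
Proof.
move=> /cube_setP Qx ti; apply/cube_setP => j; rewrite tnth_mktuple.
by case: eqP => [->|_]; [exact: ti | exact: Qx].
Qed.

Lemma cube_subset_bounds P Q i : cube_set P `<=` cube_set Q ->
  cube_lo Q i <= cube_lo P i /\ cube_hi P i <= cube_hi Q i.
Proof.
move=> PQ; have /cube_setP/(_ i)/andP[loQP loPhQ] := PQ _ (cube_corner P).
split=> //; rewrite leNgt; apply/negP => hiQP.
have /PQ/cube_setP/(_ i) : cube_set P (update P.2 i (cube_hi Q i)).
  apply: cube_set_update; first exact: cube_corner.
  by rewrite hiQP (ltW loPhQ).
by rewrite tnth_mktuple eqxx ltxx andbF.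
Qed.

Lemma cube_setS P Q :
  (forall i, cube_lo Q i <= cube_lo P i /\ cube_hi P i <= cube_hi Q i) ->
  cube_set P `<=` cube_set Q.
Proof.
move=> h x /cube_setP Px; apply/cube_setP => i.
have [h1 h2] := h i; have /andP[Px1 Px2] := Px i.
by rewrite (le_trans h1 Px1) (lt_le_trans Px2 h2).
Qed.

Lemma strictly_insideS P Q : strictly_inside P Q -> cube_set P `<=` cube_set Q.
Proof.
move=> PQ; apply: cube_setS => i; have loh := cube_lo_lt_hi Q i.
by have := PQ i; rewrite /in_half => -[[? ?]|[? ?]]; split=> //; lra.
Qed.

Lemma side_length_le P Q : (side_length P <= side_length Q) = (P.1 <= Q.1).
Proof. by rewrite /side_length ler_eXz2l// ltr1n. Qed.

Lemma haar_sign_strictly_inside P Q e x : strictly_inside P Q -> cube_set P x ->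
  haar_sign Q e x = haar_sign Q e P.2.
Proof.
move=> PQ Px; apply: eq_bigr => i _.
apply: (interval_sign_in_half _ (cube_lo_lt_hi Q i) (PQ i)).
  exact: (cube_setP P x).1.
exact: (cube_setP P P.2).1 (cube_corner P) i.
Qed.

(** The Haar function of the larger cube is constant on the smaller cube, on which
    the cancellative one integrates to 0. *)
Lemma has_integral_haar_sign_inside P Q e e' : strictly_inside P Q ->
  cancellative e ->
  has_integral (lebesgue_tuple R n)
    (fun x => haar_sign P e x * haar_sign Q e' x) 0.
Proof.
move=> PQ ce; rewrite -[X in has_integral _ _ X](mulr0 (haar_sign Q e' P.2)).
have -> : (fun x => haar_sign P e x * haar_sign Q e' x) =
    (fun x => haar_sign Q e' P.2 * haar_sign P e x).
  apply/funext => x; have [Px|Px] := pselect (cube_set P x).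
    by rewrite mulrC (haar_sign_strictly_inside _ PQ Px).
  by rewrite (haar_sign_notin _ Px) mul0r mulr0.
by have := has_integral_haar_sign P e; rewrite ce; exact: has_integralZ.
Qed.

End cube_geometry.

Section dyadic_grid.
Context (R : realType) (n : nat).
Hypothesis n_gt0 : (0 < n)%N.
Variable D : set (cube R n).
Hypothesis D_grid : dyadic_grid D.
Implicit Types (P Q C : cube R n) (x : n.-tuple R).

Lemma grid_cover (k : int) x : exists C, [/\ D C, C.1 = k & cube_set C x].
Proof.
have [/(_ k)[cov _ _] _] := D_grid.
have : [set: n.-tuple R] x by [].
by rewrite -cov => -[C [DC Ck] Cx]; exists C.
Qed.

Lemma grid_eq_scale P Q x : D P -> D Q -> P.1 = Q.1 ->
  cube_set P x -> cube_set Q x -> P = Q.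
Proof.
move=> DP DQ PQ Px Qx; have [/(_ Q.1)[_ tI _] _] := D_grid.
by apply: (tI P Q) => //; exists x.
Qed.

Lemma subset_scale P Q : cube_set P `<=` cube_set Q -> P.1 <= Q.1.
Proof.
move=> PQ; have [lo hi] := cube_subset_bounds (Ordinal n_gt0) PQ.
rewrite -side_length_le -(cube_hiBlo P (Ordinal n_gt0)) -(cube_hiBlo Q (Ordinal n_gt0)).
exact: lerB.
Qed.

Lemma grid_subset P Q x : D P -> D Q -> P.1 <= Q.1 ->
  cube_set P x -> cube_set Q x -> cube_set P `<=` cube_set Q.
Proof.
move=> DP DQ PQ Px Qx; have [_ /(_ P Q DP DQ)[|QP|PQ0]] := D_grid.
- by move/setIidPl.
- have {}QP : cube_set Q `<=` cube_set P by rewrite -QP; exact: subIsetl.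
  rewrite (grid_eq_scale DP DQ _ Px Qx)//.
  by apply/eqP; rewrite eq_le PQ subset_scale.
- have : (cube_set P `&` cube_set Q) x by [].
  by rewrite PQ0.
Qed.

(** If, in coordinate i, C started strictly between the lower end and the midpoint
    of Q, slide the corner of C along i down to the lower face of Q.  The cube C'
    of the scale of C that contains the new point starts on that face and extends
    to the midpoint of Q, so it still contains the corner of C.  By disjointness
    at a fixed scale C' = C, which contradicts their lower ends. *)
Lemma child_strictly_inside C Q : D C -> D Q -> C.1 = Q.1 - 1 ->
  cube_set C `<=` cube_set Q -> strictly_inside C Q.
Proof.
move=> DC DQ CQ subCQ i.
have sideE (C' : cube R n) : C'.1 = Q.1 - 1 -> side_length C' = side_length Q / 2.
  move=> C'Q; rewrite /side_length /cube_scale C'Q.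
  by rewrite expfzDr ?pnatr_eq0// exprN1.
have [loC hiC] := cube_subset_bounds i subCQ.
have loh := cube_lo_lt_hi Q i.
have hC := cube_hiBlo C i; have hQ := cube_hiBlo Q i.
rewrite (sideE C CQ) in hC.
rewrite /in_half.
have [|lom] := leP ((cube_lo Q i + cube_hi Q i) / 2) (cube_lo C i); first by right.
have [eqlo|nelo] := eqVneq (cube_lo C i) (cube_lo Q i).
  by left; split; lra.
exfalso.
have Qx : cube_set Q (update C.2 i (cube_lo Q i)).
  apply: cube_set_update; first exact: (subCQ _ (cube_corner C)).
  by rewrite lexx.
have [C' [DC' C'Q C'x]] := grid_cover (Q.1 - 1) (update C.2 i (cube_lo Q i)).
have subC'Q : cube_set C' `<=` cube_set Q.
  by apply: (grid_subset DC' DQ _ C'x Qx); rewrite C'Q lerBlDr lerDl.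
have [loC' _] := cube_subset_bounds i subC'Q.
have eqC'Q : cube_lo C' i = cube_lo Q i.
  have /cube_setP/(_ i) := C'x; rewrite tnth_mktuple eqxx => /andP[C'lo _].
  by apply/eqP; rewrite eq_le C'lo.
have hC' := cube_hiBlo C' i; rewrite (sideE C' C'Q) in hC'.
have C'C : cube_set C' C.2.
  apply/cube_setP => j; have /cube_setP/(_ j) := C'x; rewrite tnth_mktuple.
  case: eqP => [-> _|//]; rewrite -/(cube_lo C i); apply/andP; split; lra.
have eqCC' : C = C' by apply: (grid_eq_scale DC DC' _ (cube_corner C) C'C); rewrite C'Q.
by move: nelo; rewrite eqCC' eqC'Q eqxx.
Qed.

(** P lies in the cube C of the scale just below that of Q through the corner of P,
    and C lies in a half of Q. *)
Lemma grid_strictly_inside P Q : D P -> D Q -> P.1 < Q.1 ->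
  cube_set P `<=` cube_set Q -> strictly_inside P Q.
Proof.
move=> DP DQ PQ subPQ.
have [C [DC CQ CP]] := grid_cover (Q.1 - 1) P.2.
have subCQ : cube_set C `<=` cube_set Q.
  apply: (grid_subset DC DQ _ CP (subPQ _ (cube_corner P))).
  by rewrite CQ lerBlDr lerDl.
have subPC : cube_set P `<=` cube_set C.
  by apply: (grid_subset DP DC _ (cube_corner P) CP); rewrite CQ lerBrDr lezD1.
have CinQ := child_strictly_inside DC DQ CQ subCQ.
move=> i; have [lo hi] := cube_subset_bounds i subPC.
by have := CinQ i; rewrite /in_half => -[[? ?]|[? ?]]; [left|right]; split; lra.
Qed.

Lemma grid_cases P Q : D P -> D Q ->
  [\/ P = Q, strictly_inside P Q, strictly_inside Q P
    | forall x, cube_set P x -> ~ cube_set Q x].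
Proof.
move=> DP DQ; have [[x [Px Qx]]|h] := pselect (exists x, cube_set P x /\ cube_set Q x); last first.
  by constructor 4 => x Px Qx; apply: h; exists x.
have [PQ|QP|PQ] := ltgtP P.1 Q.1.
- constructor 2; apply: grid_strictly_inside => //.
  exact: (grid_subset DP DQ (ltW PQ) Px Qx).
- constructor 3; apply: grid_strictly_inside => //.
  exact: (grid_subset DQ DP (ltW QP) Qx Px).
- constructor 1; exact: (grid_eq_scale DP DQ PQ Px Qx).
Qed.

Lemma haar_sign_orthogonal P Q e e' : D P -> D Q -> P <> Q ->
  cancellative e -> cancellative e' ->
  has_integral (lebesgue_tuple R n)
    (fun x => haar_sign P e x * haar_sign Q e' x) 0.
Proof.
move=> DP DQ PQ ce ce'; have [//|PinQ|QinP|dPQ] := grid_cases DP DQ.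
- exact: has_integral_haar_sign_inside.
- under eq_fun do rewrite mulrC.
  exact: has_integral_haar_sign_inside.
- rewrite (_ : (fun _ => _) = fun=> 0); first exact: has_integral0.
  apply/funext => x; have [Px|Px] := pselect (cube_set P x).
    by rewrite (haar_sign_notin _ (dPQ _ Px)) mulr0.
  by rewrite (haar_sign_notin _ Px) mul0r.
Qed.

(** At a fixed scale, two cubes whose corners have the same integer parts in units
    of the side differ by less than a side in each coordinate, so they meet and are
    equal; scale and integer parts therefore determine a cube. *)
Lemma grid_countable : exists code : cube R n -> nat, {in D &, injective code}.
Proof.
exists (fun Q => pickle (Q.1,
  [tuple Num.floor (cube_lo Q i / side_length Q) | i < n])).
move=> P Q /set_mem DP /set_mem DQ /(pcan_inj pickleK)/pair_equal_spec[PQ fPQ].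
have sPQ : side_length P = side_length Q by rewrite /side_length /cube_scale PQ.
have s0 := side_length_gt0 Q.
have near i : `|cube_lo P i - cube_lo Q i| < side_length Q.
  have /(congr1 (fun t => tnth t i)) := fPQ; rewrite !tnth_mktuple sPQ => fi.
  have := floor_itv (cube_lo P i / side_length Q); rewrite fi.
  have := floor_itv (cube_lo Q i / side_length Q).
  move: (Num.floor _) => z; rewrite intrD.
  rewrite !ler_pdivlMr// !ltr_pdivrMr// => /andP[Q1 Q2] /andP[P1 P2].
  by rewrite ltr_norml; apply/andP; split; lra.
pose x : n.-tuple R := [tuple Num.max (cube_lo P i) (cube_lo Q i) | i < n].
have Px : cube_set P x.
  apply/cube_setP => i; rewrite tnth_mktuple le_max lexx/= gt_max cube_lo_lt_hi/=.
  by have := cube_hiBlo P i; have := near i; rewrite ltr_norml => /andP[]; lra.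
have Qx : cube_set Q x.
  apply/cube_setP => i; rewrite tnth_mktuple le_max lexx orbT/= gt_max cube_lo_lt_hi/= andbT.
  by have := cube_hiBlo Q i; have := near i; rewrite ltr_norml => /andP[]; lra.
exact: grid_eq_scale Px Qx.
Qed.

End dyadic_grid.

(** * The finite sum of Haar functions attached to a family of cubes *)

Section integral_on_cube.
Context (R : realType) (n : nat).
Local Notation leb := (lebesgue_tuple R n).

Lemma integral_cube_set (Q : cube R n) (f g : n.-tuple R -> R) v :
  has_integral leb g v -> (forall x, cube_set Q x -> f x = g x) ->
  (forall x, ~ cube_set Q x -> g x = 0) ->
  (\int[leb]_(x in cube_set Q) (f x)%:E = v%:E)%E.
Proof.
move=> [_ gv] fg g0; rewrite integral_mkcond -gv; apply: eq_integral => x _.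
rewrite patchE; case: ifPn => [/set_mem Qx|/negP Qx]; first by rewrite fg.
by rewrite g0// => /mem_set.
Qed.

Lemma divr_leb_cube_set (Q : cube R n) (v : R) :
  (v%:E / leb (cube_set Q) = (v / volume Q)%:E)%E.
Proof. by rewrite leb_cube_set inver gt_eqF ?volume_gt0. Qed.

End integral_on_cube.

Section haar_sum.
Context (R : realType) (n : nat).
Hypothesis n_gt0 : (0 < n)%N.
Variable D : set (cube R n).
Hypothesis D_grid : dyadic_grid D.
Variable e0 : {ffun 'I_n -> bool}.
Hypothesis e0_cancel : cancellative e0.
Implicit Types (P Q : cube R n) (s : seq (cube R n)) (x : n.-tuple R).
Local Notation leb := (lebesgue_tuple R n).

Definition haar_sum s x : R := \sum_(P <- s) haar_sign P e0 x.

Lemma has_integral_haar_sum s : has_integral leb (haar_sum s) 0.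
Proof.
have -> : 0 = \sum_(P <- s) 0 :> R by rewrite big1.
apply: has_integral_sum => P _.
by have := has_integral_haar_sign P e0; rewrite e0_cancel.
Qed.

(** Only the term of Q itself contributes, and only if the patterns agree. *)
Lemma has_integral_haar_sumM s Q e : {subset s <= D} -> uniq s -> D Q ->
  cancellative e ->
  has_integral leb (fun x => haar_sum s x * haar_sign Q e x)
    (if (Q \in s) && (e == e0) then volume Q else 0).
Proof.
move=> sD us DQ ce.
have -> : (if (Q \in s) && (e == e0) then volume Q else 0) =
    \sum_(P <- s) (if (P == Q) && (e == e0) then volume Q else 0).
  have [Qs|Qs] := boolP (Q \in s).
    rewrite (bigD1_seq Q)//= eqxx/= big1 ?addr0// => P /negbTE ->//.
  rewrite big_seq big1// => P Ps.
  by case: eqP => //= PQ; move: Qs; rewrite -PQ Ps.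
rewrite /haar_sum; under eq_fun do rewrite mulr_suml.
apply: has_integral_sum => P /sD/set_mem DP.
have [->|PQ] /= := eqVneq P Q; last first.
  by apply: (haar_sign_orthogonal n_gt0 D_grid) => //; exact/eqP.
under eq_fun do rewrite haar_signM.
have := has_integral_haar_sign Q [ffun i => e0 i == e i].
congr (has_integral _ _ _); rewrite /cancellative.
have [->|ne] /= := eqVneq e e0.
  suff -> : [ffun i => e0 i == e0 i] = [ffun=> true] by rewrite eqxx.
  by apply/ffunP => i; rewrite !ffunE eqxx.
case: eqP => //= /ffunP h; case/eqP: ne; apply/ffunP => i.
by have := h i; rewrite !ffunE => /eqP.
Qed.

Lemma pairing_haar_sum s Q e : {subset s <= D} -> uniq s -> D Q ->
  cancellative e ->
  pairing (haar_sum s) (haar Q e) =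
  (Num.sqrt (side_length Q) ^+ n)^-1 *
    (if (Q \in s) && (e == e0) then volume Q else 0).
Proof.
move=> sD us DQ ce; set k := (_ ^+ n)^-1.
have [_] := has_integralZ k (has_integral_haar_sumM sD us DQ ce).
rewrite /pairing /Rintegral => h; rewrite -[RHS]/(fine (_%:E)) -h.
congr fine; apply: eq_integral => x _.
by rewrite haarE -/k mulrCA.
Qed.

(** Only Q in s and e = e0 give a nonzero term, whose coefficient is the square
    of (b, h_Q^e0) = |Q|^(1/2), that is |Q|, divided by |Q|. *)
Lemma paraproduct_haar_sum s (f : n.-tuple R -> R) :
  {subset s <= D} -> uniq s ->
  paraproduct_composition D (haar_sum s) (haar_sum s) f =
  sparse_operator [set` s] f.
Proof.
move=> sD us; apply/funext => x.
rewrite /paraproduct_composition /sparse_operator /signed_sum.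
set g' := (X in (EFin \o X)^\+%E); set g := (X in (_ = \esum_(Q in _) (EFin \o X)^\+ Q - _)%E).
have gE Q : D Q -> g' Q = if Q \in s then g Q else 0.
  move=> DQ; rewrite /g' /g; have [Qs|Qs] := ifP; last first.
    rewrite big1// => e ce.
    by rewrite pairing_haar_sum// Qs/= mulr0 !mul0r.
  rewrite (bigD1 e0)//= big1 ?addr0; last first.
    move=> e /andP[ce /negbTE ee0].
    by rewrite pairing_haar_sum// ee0 andbF mulr0 !mul0r.
  rewrite pairing_haar_sum// Qs eqxx/= leb_cube_set/=.
  have s0 := side_length_gt0 Q.
  have k0 : Num.sqrt (side_length Q) ^+ n != 0.
    by rewrite expf_neq0// gt_eqF// sqrtr_gt0.
  rewrite (_ : volume Q = Num.sqrt (side_length Q) ^+ n * Num.sqrt (side_length Q) ^+ n).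
    by field.
  by rewrite -exprMn -expr2 sqr_sqrtr// ltW.
have setE : D `&` [set` s] = [set` s].
  by apply/setIidPr => Q Qs; exact/set_mem/sD.
rewrite -setE !esum_mkcondr; congr (_ - _)%E; apply: eq_esum => Q DQ.
- rewrite !funeposE; change (maxe (g' Q)%:E 0 =
    if Q \in [set` s] then maxe (g Q)%:E 0 else 0)%E.
  by rewrite gE// mem_setE; case: ifP => // _; rewrite maxxx.
- rewrite !funenegE; change (maxe (- (g' Q)%:E) 0 =
    if Q \in [set` s] then maxe (- (g Q)%:E) 0 else 0)%E.
  by rewrite gE// mem_setE; case: ifP => // _; rewrite oppe0 maxxx.
Qed.

Definition inside_seq s Q := [seq P <- s | `[< cube_set P `<=` cube_set Q >]].

(** The cubes of s not contained in Q are disjoint from Q or strictly larger; in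
    both cases their Haar functions are constant on Q, with the value at the corner
    of Q. *)
Lemma haar_sum_inside s Q x : {subset s <= D} -> D Q -> cube_set Q x ->
  haar_sum s x = haar_sum (inside_seq s Q) x +
    \sum_(P <- s | ~~ `[< cube_set P `<=` cube_set Q >]) haar_sign P e0 Q.2.
Proof.
move=> sD DQ Qx; rewrite /haar_sum big_filter.
rewrite (bigID (fun P => `[< cube_set P `<=` cube_set Q >]))/=; congr (_ + _).
rewrite [LHS]big_seq_cond [RHS]big_seq_cond.
apply: eq_bigr => P /andP[/sD/set_mem DP /asboolPn nPQ].
have [PQ|PinQ|QinP|dPQ] := grid_cases n_gt0 D_grid DP DQ.
- by case: nPQ; rewrite PQ.
- by case: nPQ; exact: strictly_insideS.
- exact: haar_sign_strictly_inside.
- rewrite !haar_sign_notin//; first by move=> /dPQ; apply; exact: cube_corner.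
  by move=> /dPQ; apply.
Qed.

Lemma haar_sum_inside_notin s Q x : ~ cube_set Q x -> haar_sum (inside_seq s Q) x = 0.
Proof.
move=> Qx; rewrite /haar_sum big_filter big1// => P /asboolP PQ.
by rewrite haar_sign_notin// => /PQ.
Qed.

Lemma has_integral_haar_sum_sqr s : {subset s <= D} -> uniq s ->
  has_integral leb (fun x => haar_sum s x ^+ 2) (\sum_(P <- s) volume P).
Proof.
move=> sD us; under eq_fun do rewrite expr2 {2}/haar_sum mulr_sumr.
apply: has_integral_sum => P Ps.
have DP : D P by exact/set_mem/sD.
by have := has_integral_haar_sumM sD us DP e0_cancel; rewrite Ps eqxx.
Qed.

Section oscillation.
Variable s : seq (cube R n).
Hypotheses (sD : {subset s <= D}) (us : uniq s).

Let sQD Q : {subset inside_seq s Q <= D}.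
Proof. by move=> P; rewrite mem_filter => /andP[_ /sD]. Qed.

Let usQ Q : uniq (inside_seq s Q). Proof. exact: filter_uniq. Qed.

Lemma avg_haar_sum Q : D Q -> avg (haar_sum s) Q =
  (\sum_(P <- s | ~~ `[< cube_set P `<=` cube_set Q >]) haar_sign P e0 Q.2)%:E.
Proof.
move=> DQ; set k := \sum_(P <- s | _) _; rewrite /avg.
have := has_integralD (has_integral_haar_sum (inside_seq s Q))
  (has_integralZ k (has_integral_haar_sign Q [ffun=> true])).
rewrite /cancellative eqxx/= add0r => /integral_cube_set ->.
- by rewrite divr_leb_cube_set mulfK// gt_eqF// volume_gt0.
- by move=> x Qx; rewrite (haar_sum_inside sD DQ Qx) haar_sign_true indicE mem_set// mulr1.
- move=> x Qx; rewrite haar_sum_inside_notin// haar_sign_true indicE memNset//.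
  by rewrite mulr0 addr0.
Qed.

Lemma oscillation_haar_sum Q : D Q ->
  avg (fun x => `|haar_sum s x - fine (avg (haar_sum s) Q)|) Q =
  avg (fun x => `|haar_sum (inside_seq s Q) x|) Q.
Proof.
move=> DQ; rewrite avg_haar_sum// /avg; congr (_ / _)%E.
apply: eq_integral => x /set_mem Qx.
by rewrite /= (haar_sum_inside sD DQ Qx) addrK.
Qed.

Let measurable_haar_sum s' : measurable_fun setT (haar_sum s').
Proof.
by have [/measurable_int/measurable_EFinP] := has_integral_haar_sum s'.
Qed.

(** Testing the oscillation against the Haar function of Q, bounded by 1, already
    gives the volume of Q. *)
Lemma oscillation_haar_sum_ge1 Q : D Q -> Q \in s ->
  (1 <= avg (fun x => `|haar_sum s x - fine (avg (haar_sum s) Q)|)%R Q)%E.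
Proof.
move=> DQ Qs; rewrite oscillation_haar_sum// /avg.
have Qins : Q \in inside_seq s Q by rewrite mem_filter Qs andbT; exact/asboolP.
have := has_integral_haar_sumM (@sQD Q) (usQ Q) DQ e0_cancel.
rewrite Qins eqxx/= => hF.
have h0 x : ~ cube_set Q x -> haar_sum (inside_seq s Q) x * haar_sign Q e0 x = 0.
  by move=> Qx; rewrite (haar_sign_notin e0 Qx) mulr0.
have mQ := measurable_cube_set Q.
rewrite leb_cube_set inver gt_eqF ?volume_gt0// lee_pdivlMr ?volume_gt0// mul1e.
rewrite -(integral_cube_set hF (fun _ _ => erefl) h0).
apply: le_integral => //.
- by apply: integrableS hF.1.
- have := integrable_abse (has_integral_haar_sum (inside_seq s Q)).1.
  exact: integrableS.
- move=> x _; rewrite lee_fin (le_trans (ler_norm _))// normrM ler_piMr//.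
  exact: haar_sign_le1.
Qed.

(** The pointwise bound 2 c |F| <= F^2 + c^2 replaces the Cauchy-Schwarz
    inequality and loses nothing for this c. *)
Lemma oscillation_haar_sum_le (c : R) Q : D Q -> 0 < c ->
  \sum_(P <- inside_seq s Q) volume P <= c ^+ 2 * volume Q ->
  (avg (fun x => `|haar_sum s x - fine (avg (haar_sum s) Q)|)%R Q <= c%:E)%E.
Proof.
move=> DQ c0 sumQ; rewrite oscillation_haar_sum// /avg.
set F := haar_sum (inside_seq s Q).
have := has_integralD
  (has_integralZ (2 * c)^-1 (has_integral_haar_sum_sqr (@sQD Q) (usQ Q)))
  (has_integralZ (c / 2) (has_integral_haar_sign Q [ffun=> true])).
rewrite /cancellative eqxx/=; set V := \sum_(P <- _) _; set G := fun x => _.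
move=> hG.
have G0 x : ~ cube_set Q x -> G x = 0.
  move=> Qx; rewrite /G haar_sum_inside_notin// haar_sign_notin//.
  by rewrite expr0n mulr0 mulr0 addr0.
have FG x : cube_set Q x -> `|F x| <= G x.
  move=> Qx; rewrite /G -/(F x) haar_sign_true indicE mem_set// mulr1.
  rewrite -(real_normK (num_real (F x))).
  rewrite -(ler_pM2l (_ : 0 < 2 * c)) ?mulr_gt0// mulrDr mulVKf ?gt_eqF ?mulr_gt0//.
  have : 0 <= (`|F x| - c) ^+ 2 by exact: sqr_ge0.
  by nra.
have mG : measurable_fun setT G by apply/measurable_EFinP/measurable_int/hG.1.
have := integral_cube_set hG (fun _ _ => erefl) G0 => GQ.
have iFG : (\int[leb]_(x in cube_set Q) `|F x|%:E <=
    \int[leb]_(x in cube_set Q) (G x)%:E)%E.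
  apply: ge0_le_integral => //.
  - exact: measurable_cube_set.
  - apply/measurable_EFinP/measurable_funTS.
    by apply: measurableT_comp => //; exact: measurable_haar_sum.
  - exact/measurable_EFinP/measurable_funTS.
rewrite leb_cube_set inver gt_eqF ?volume_gt0//.
rewrite lee_pdivrMr ?volume_gt0//; apply: le_trans iFG _.
rewrite GQ -EFinM lee_fin.
rewrite -(ler_pM2l (_ : 0 < 2 * c)) ?mulr_gt0// mulrDr mulVKf ?gt_eqF ?mulr_gt0//.
by apply: le_trans (lerD sumQ (lexx _)) _; rewrite le_eqVlt; apply/orP; left; apply/eqP; field.
Qed.

Lemma locally_integrable_haar_sum : locally_integrable_tuple (haar_sum s).
Proof.
split; first exact: measurable_haar_sum.
move=> r; apply: (@integrableS _ _ _ _ setT) => //; last first.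
  by have [] := has_integral_haar_sum s.
rewrite (_ : [set x | _] =
    \bigcap_(i in [set: 'I_n]) ((fun x : n.-tuple R => tnth x i) @^-1` `[-r, r]%classic)).
  apply: fin_bigcap_measurable => // i _; rewrite -[X in measurable X]setTI.
  have mi : measurable_fun setT (fun x : n.-tuple R => tnth x i) := measurable_tnth i.
  exact: mi.
apply/seteqP; split => x /= h i; first by move=> _; rewrite /= in_itv/= -ler_norml.
by have := h i I; rewrite /= in_itv/= -ler_norml.
Qed.

End oscillation.
End haar_sum.

(** * BMO norm under the Carleson condition *)

Section bmo_bounds.
Context (R : realType) (n : nat).
Hypothesis n_gt0 : (0 < n)%N.
Variable D : set (cube R n).
Hypothesis D_grid : dyadic_grid D.
Variable e0 : {ffun 'I_n -> bool}.
Hypothesis e0_cancel : cancellative e0.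
Variables (L : R) (s : seq (cube R n)).
Hypotheses (L_gt0 : 0 < L) (sD : {subset s <= D}) (us : uniq s).
Hypothesis s_carleson : carleson D L [set` s].

Lemma carleson_seq Q : D Q -> \sum_(P <- inside_seq s Q) volume P <= L * volume Q.
Proof.
move=> DQ; have := s_carleson DQ; rewrite leb_cube_set -EFinM.
rewrite -lee_fin; apply: le_trans.
apply: esum_ge; exists [set` inside_seq s Q].
  split; first exact: finite_seq.
  by move=> P /=; rewrite mem_filter => /andP[/asboolP].
rewrite -fsbig_seq ?filter_uniq//= -sumEFin.
by under [leRHS]eq_bigr do rewrite leb_cube_set.
Qed.

Lemma bmo_norm_haar_sum_le : (bmo_norm D (haar_sum e0 s) <= (Num.sqrt L)%:E)%E.
Proof.
apply: ge_ereal_sup => _ [Q DQ <-].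
apply: (oscillation_haar_sum_le n_gt0 D_grid) => //; first by rewrite sqrtr_gt0.
by rewrite sqr_sqrtr ?(ltW L_gt0)// carleson_seq.
Qed.

Lemma bmo_norm_haar_sum_ge1 : s != [::] -> (1 <= bmo_norm D (haar_sum e0 s))%E.
Proof.
case: s sD us => // Q s' sD' us' _; have Qs : Q \in Q :: s' by rewrite mem_head.
have DQ : D Q by exact/set_mem/sD'.
apply: le_trans (oscillation_haar_sum_ge1 n_gt0 D_grid e0_cancel sD' us' DQ Qs) _.
by apply: ereal_sup_ubound; exists Q.
Qed.

Lemma bmo_haar_sum : bmo D (haar_sum e0 s).
Proof.
split; first exact: locally_integrable_haar_sum.
exact: le_lt_trans bmo_norm_haar_sum_le (ltry _).
Qed.

End bmo_bounds.

(** * Domination of a sparse operator by its values on nonnegative functions *)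

Section sparse_domination.
Context (R : realType) (n : nat).
Implicit Types (Q : cube R n) (S : set (cube R n)) (f : n.-tuple R -> R).
Local Notation leb := (lebesgue_tuple R n).
Local Open Scope ereal_scope.

Lemma abse_signed_sum_le S (g : cube R n -> R) :
  `|signed_sum S g| <= \esum_(Q in S) `|(g Q)%:E|.
Proof.
apply: le_trans (lee_abs_sub _ _) _.
rewrite !gee0_abs; last 2 first.
- by apply: esum_ge0 => Q _; exact: funeneg_ge0.
- by apply: esum_ge0 => Q _; exact: funepos_ge0.
rewrite -esumD//.
apply: le_esum => Q _.
by rewrite -[leRHS]/((abse \o (EFin \o g)) Q) fune_abse.
Qed.

(** When |f| is not integrable on Q the average of f is infinite or a difference of
    infinities, hence not a finite number either, and both sides are 0. *)
Lemma normr_fine_avg_le f Q : measurable_fun setT f ->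
  (`|fine (avg f Q)| <= fine (avg (fun x => `|f x|) Q))%R.
Proof.
move=> mf; have mQ := measurable_cube_set Q.
have mfQ := measurable_funTS (D := cube_set Q) mf.
have v0 := volume_gt0 Q.
rewrite /avg leb_cube_set inver gt_eqF//.
have v0' : (0 < (volume Q)^-1)%R by rewrite invr_gt0.
have [If|If] := boolP (\int[leb]_(x in cube_set Q) (f x)%:E \is a fin_num); last first.
  have -> : fine (\int[leb]_(x in cube_set Q) (f x)%:E * ((volume Q)^-1)%:E) = 0%R.
    move: If; rewrite fin_numEn => /orP[|] /eqP ->.
      by rewrite gt0_mulNye.
    by rewrite gt0_mulye.
  rewrite normr0 fine_ge0// mule_ge0 ?lee_fin ?(ltW v0')//.
  by apply: integral_ge0 => x _; rewrite lee_fin.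
have Iabs : \int[leb]_(x in cube_set Q) (`|f x|)%:E \is a fin_num.
  rewrite ge0_fin_numE; last by apply: integral_ge0 => x _; rewrite lee_fin.
  by rewrite -(integral_fin_num_abs leb mQ mfQ) in If.
rewrite !fineM// normrM (gtr0_norm v0') ler_wpM2r ?(ltW v0')//.
rewrite -fine_abse// fine_le//; first by rewrite abse_fin_num.
by apply: le_abse_integral => //; exact/measurable_EFinP.
Qed.

Lemma sparse_term_ge0 f Q x : (forall y, 0 <= f y)%R ->
  (0 <= fine (avg f Q) * \1_(cube_set Q) x)%R.
Proof.
move=> f0; rewrite mulr_ge0// ?indicE ?ler0n// fine_ge0//.
rewrite /avg leb_cube_set inver gt_eqF ?volume_gt0//.
rewrite mule_ge0 ?lee_fin ?invr_ge0 ?(ltW (volume_gt0 Q))//.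
by apply: integral_ge0 => y _; rewrite lee_fin.
Qed.

Lemma sparse_operator_ge0E S f x : (forall y, 0 <= f y)%R ->
  sparse_operator S f x =
  \esum_(Q in S) (fine (avg f Q) * \1_(cube_set Q) x)%:E.
Proof.
move=> f0; have t0 Q := sparse_term_ge0 Q x f0.
rewrite /sparse_operator /signed_sum [X in _ - X]esum1 ?sube0.
  by apply: eq_esum => Q _; rewrite funeposE; apply/max_idPl; rewrite lee_fin.
by move=> Q _; rewrite funenegE; apply/max_idPr; rewrite -EFinN lee_fin oppr_le0.
Qed.

Lemma abse_sparse_operator_le S f x : measurable_fun setT f ->
  `|sparse_operator S f x| <= sparse_operator S (fun y => `|f y|%R) x.
Proof.
move=> mf; rewrite [leRHS]sparse_operator_ge0E// /sparse_operator.
apply: (le_trans (abse_signed_sum_le S _)); apply: le_esum => Q _.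
rewrite abse_EFin lee_fin normrM [X in (_ * X <= _)%R]ger0_norm ?indicE ?ler0n//.
by rewrite ler_wpM2r ?ler0n// normr_fine_avg_le.
Qed.

End sparse_domination.

(** * Passage from finite families to arbitrary ones *)

Section monotonicity.
Local Open Scope ereal_scope.

(** The integral of a nonnegative function is the supremum of the integrals of the
    simple functions below it, hence monotone on all nonnegative functions. *)
Lemma ge0_le_integralT d (T : measurableType d) (R : realType)
    (m : {measure set T -> \bar R})
    (f g : T -> \bar R) :
  (forall x, 0 <= f x) -> (forall x, f x <= g x) ->
  \int[m]_x f x <= \int[m]_x g x.
Proof.
move=> f0 fg; have g0 x : 0 <= g x by exact: le_trans (f0 x) (fg x).
rewrite !ge0_integralTE//; apply: ereal_sup_le => _ [h hf <-].
by exists h => // x; exact: le_trans (hf x) (fg x).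
Qed.

Lemma ler_poweR_ge0 (R : realType) (r : R) (x y : \bar R) : (0 <= r)%R -> 0 <= x -> x <= y ->
  x `^ r <= y `^ r.
Proof.
move=> r0 x0 xy; apply: gt0_ler_poweR => //; rewrite in_itv/= ?x0 ?leey//.
by rewrite (le_trans x0 xy).
Qed.

End monotonicity.

Section weighted_norm.
Context (R : realType) (n : nat) (p : R) (w : weight R n).
Hypothesis p_gt1 : (1 < p)%R.
Implicit Types (f : n.-tuple R -> R) (S : set (cube R n)).
Local Notation mu := (weighted_measure w).
Local Open Scope ereal_scope.

Let p_gt0 : (0 < p)%R. Proof. exact: lt_trans p_gt1. Qed.

Lemma Lfun_normr f : f \in Lfun mu p%:E -> (fun x => `|f x|%R) \in Lfun mu p%:E.
Proof.
move=> /andP[mf ff]; apply/andP; split.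
  rewrite inE /=; rewrite inE /= in mf; exact: measurableT_comp.
move: ff; rewrite !inE /finite_norm /=.
by rewrite -(Lnorm_abse _ (EFin \o f)).
Qed.

Lemma weighted_opnorm_ge0 (T : (n.-tuple R -> R) -> n.-tuple R -> \bar R) :
  0 <= weighted_opnorm p w T.
Proof.
have N0 : 'N[mu]_(p%:E)[EFin \o (cst 0%R : n.-tuple R -> R)] = 0.
  by rewrite -[RHS](Lnorm0 mu (_ : p%:E != 0))// eqe gt_eqF.
apply: le_trans (Lnorm_ge0 mu p%:E (T (cst 0%R))) _.
apply: ereal_sup_ubound; exists (cst 0%R) => //=; split; last by rewrite N0.
apply/andP; split; rewrite inE /=; first exact: measurable_cst.
by rewrite /finite_norm N0.
Qed.

Lemma poweRK (x : \bar R) : 0 <= x -> (x `^ p) `^ p^-1 = x.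
Proof. by move=> x0; rewrite -poweRrM mulfV ?gt_eqF// poweRe1. Qed.

(** The code enumerates S; the cubes of code less than N form the N-th finite
    subfamily. *)
Section exhaustion.
Variables (S : set (cube R n)) (code : cube R n -> nat) (C : \bar R).
Hypothesis code_inj : {in S &, injective code}.
Hypothesis C_ge0 : 0 <= C.
Hypothesis C_bound : forall s : seq (cube R n), uniq s -> [set` s] `<=` S ->
  weighted_opnorm p w (sparse_operator [set` s]) <= C.

Let trunc N : set (cube R n) := S `&` [set Q | (code Q < N)%N].

Let trunc_seq N : exists2 s, uniq s & trunc N = [set` s].
Proof.
have : finite_set (trunc N).
  rewrite -(eq_finite_set (inj_card_eq _ : (code @` trunc N #= trunc N)%card)).
    by apply: sub_finite_set (finite_II N) => _ [Q [_ QN] <-].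
  by move=> P Q /set_mem[SP _] /set_mem[SQ _]; apply: code_inj; exact/mem_set.
move=> /finite_seqP[s sE]; exists (undup s); first exact: undup_uniq.
by rewrite sE; apply/seteqP; split => Q /=; rewrite mem_undup.
Qed.

Variable f : n.-tuple R -> R.
Hypothesis f_Lfun : f \in Lfun mu p%:E.
Hypothesis f_norm : 'N[mu]_(p%:E)[EFin \o f] <= 1.

Let h (x : n.-tuple R) : R := `|f x|%R.

Let h_ge0 x : (0 <= h x)%R. Proof. exact: normr_ge0. Qed.

Let term Q x : \bar R := (fine (avg h Q) * \1_(cube_set Q) x)%:E.

Let term_ge0 Q x : 0 <= term Q x.
Proof.
by rewrite lee_fin; exact: sparse_term_ge0.
Qed.

Let partial N x : \bar R := \esum_(Q in trunc N) term Q x.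

Let partial_ge0 N x : 0 <= partial N x.
Proof. by apply: esum_ge0 => Q _; exact: term_ge0. Qed.

Let measurable_partial N : measurable_fun setT (partial N).
Proof.
have [s us sE] := trunc_seq N.
have -> : partial N = fun x => \sum_(Q <- s) term Q x.
  apply/funext => x; rewrite /partial sE esum_fset; last first.
  - by move=> Q _; exact: term_ge0.
  - exact: finite_seq.
  by rewrite -fsbig_seq.
apply: emeasurable_sum => Q; apply/measurable_EFinP.
apply: measurable_funM => //; exact: measurable_indic (measurable_cube_set Q).
Qed.

Let partial_homo x : {homo partial^~ x : N M / (N <= M)%N >-> N <= M}.
Proof.
move=> N M NM; apply: ereal_sup_le => _ [X [fX XN] <-]; exists X => //; split=> //.
by move=> Q /XN[SQ QN]; split=> //; exact: leq_trans QN NM.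
Qed.

Let integral_partial_le N : \int[mu]_x (partial N x `^ p) <= C `^ p.
Proof.
have [s us sE] := trunc_seq N.
have pE : partial N = sparse_operator [set` s] h.
  by apply/funext => x; rewrite (sparse_operator_ge0E _ _ h_ge0) /partial sE.
have -> : \int[mu]_x (partial N x `^ p) = 'N[mu]_(p%:E)[partial N] `^ p.
  rewrite poweR_Lnorm ?gt_eqF//; apply: eq_integral => x _.
  by rewrite gee0_abs.
apply: ler_poweR_ge0; [exact: ltW|exact: Lnorm_ge0|].
apply: le_trans (C_bound us _); last by rewrite -sE => Q [].
apply: ereal_sup_ubound; exists h; last by rewrite pE.
split; first exact: Lfun_normr.
by move: f_norm; rewrite -(Lnorm_abse mu (EFin \o f)).
Qed.

(** The power p is moved to the other side, where the supremum over finite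
    subfamilies can be tested one at a time. *)
Let esum_le_lim x : (\esum_(Q in S) term Q x) `^ p <= limn (fun N => partial N x `^ p).
Proof.
set c := limn _.
have homoP : {homo (fun N => partial N x `^ p) : N M / (N <= M)%N >-> N <= M}.
  by move=> N M NM; apply: ler_poweR_ge0; rewrite ?(ltW p_gt0)//; exact: partial_homo.
have pc N : partial N x `^ p <= c.
  apply: lime_ge; first exact: ereal_nondecreasing_is_cvgn.
  by exists N => // M /= NM; exact: homoP.
have c0 : 0 <= c by apply: le_trans (pc 0%N); exact: poweR_ge0.
rewrite -[c](poweRK c0) -poweRrM mulrC poweRrM.
apply: ler_poweR_ge0; first exact: ltW.
  by apply: esum_ge0 => Q _; exact: term_ge0.
apply: ge_ereal_sup => _ [X [fX XS] <-].
have /finite_seqP[s sE] := fX.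
pose N := (\max_(Q <- s) code Q).+1.
apply: (@le_trans _ _ (partial N x)).
  apply: esum_ge; exists X => //; split=> // Q XQ; split; first exact: XS.
  rewrite /= ltnS; apply: leq_bigmax_seq => //.
  by move: XQ; rewrite sE.
rewrite -[leLHS]poweRK//; apply: ler_poweR_ge0 => //.
- by rewrite invr_ge0 ltW.
- exact: poweR_ge0.
Qed.

(** Monotone convergence for the powers of the operators of the finite
    subfamilies applied to |f|, which has the same norm as f. *)
Lemma Lnorm_sparse_operator_le : 'N[mu]_(p%:E)[sparse_operator S f] <= C.
Proof.
have mf : measurable_fun setT f by case/andP: f_Lfun; rewrite inE.
rewrite -[leRHS]poweRK// unlock; apply: ler_poweR_ge0.
- by rewrite invr_ge0 ltW.
- by apply: integral_ge0 => x _; exact: poweR_ge0.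
apply: (@le_trans _ _ (\int[mu]_x limn (fun N => partial N x `^ p))).
  apply: ge0_le_integralT => x; first exact: poweR_ge0.
  apply: le_trans (esum_le_lim x); apply: ler_poweR_ge0; rewrite ?(ltW p_gt0)//.
  apply: le_trans (abse_sparse_operator_le _ _ mf) _.
  by rewrite sparse_operator_ge0E.
rewrite (@monotone_convergence _ _ _ mu setT measurableT (fun N x => partial N x `^ p)).
- apply: lime_le; last by apply: nearW => N; exact: integral_partial_le.
  apply: ereal_nondecreasing_is_cvgn => N M NM.
  apply: ge0_le_integralT => x; first exact: poweR_ge0.
  by apply: ler_poweR_ge0; rewrite ?(ltW p_gt0)//; exact: partial_homo.
- by move=> N; exact: (measurableT_comp (measurable_poweR p) (measurable_partial N)).
- by move=> N x _; exact: poweR_ge0.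
- move=> x _ N M NM.
  by apply: ler_poweR_ge0; rewrite ?(ltW p_gt0)//; exact: partial_homo.
Qed.

End exhaustion.

Lemma weighted_opnorm_sparse_le S (code : cube R n -> nat) (C : \bar R) :
  {in S &, injective code} -> 0 <= C ->
  (forall s : seq (cube R n), uniq s -> [set` s] `<=` S ->
    weighted_opnorm p w (sparse_operator [set` s]) <= C) ->
  weighted_opnorm p w (sparse_operator S) <= C.
Proof.
move=> ci C0 Cs; apply: ge_ereal_sup => _ [f [fL f1] <-].
exact: (Lnorm_sparse_operator_le ci C0 Cs).
Qed.

End weighted_norm.

(** * Comparison of the norms *)

Section sparse_le_paraproduct.
Context (R : realType) (n : nat).
Hypothesis n_gt0 : (0 < n)%N.
Variables (D : set (cube R n)) (p : R) (w : weight R n).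
Hypothesis D_grid : dyadic_grid D.
Hypothesis p_gt1 : 1 < p.
Local Open Scope ereal_scope.

Definition paraproduct_ratio : \bar R :=
  ereal_sup [set weighted_opnorm p w (paraproduct_composition D ab.1 ab.2)
                    / (bmo_norm D ab.1 * bmo_norm D ab.2) | ab in
      [set ab : (n.-tuple R -> R) * (n.-tuple R -> R) |
        [/\ bmo D ab.1, bmo D ab.2, bmo_norm D ab.1 != 0 &
          bmo_norm D ab.2 != 0]]].

Let e0 : {ffun 'I_n -> bool} := [ffun=> false].

Let e0_cancel : cancellative e0.
Proof. by apply/eqP => /ffunP/(_ (Ordinal n_gt0)); rewrite !ffunE. Qed.

(** The constant c is the square of the BMO norm of the Haar sum of s, used for
    both symbols. *)
Lemma sparse_opnorm_finite (L : R) (s : seq (cube R n)) : (0 < L)%R ->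
  {subset s <= D} -> uniq s -> carleson D L [set` s] -> s != [::] ->
  exists2 c : R, (0 < c <= L)%R &
    weighted_opnorm p w (sparse_operator [set` s]) * (c^-1)%:E <= paraproduct_ratio.
Proof.
move=> L0 sD us cs s0; pose b := haar_sum e0 s.
have b1 : 1 <= bmo_norm D b by exact: bmo_norm_haar_sum_ge1.
have bL : bmo_norm D b <= (Num.sqrt L)%:E by exact: bmo_norm_haar_sum_le.
have bmo_b : bmo D b by exact: bmo_haar_sum L0 sD us cs.
have bfin : bmo_norm D b \is a fin_num.
  by rewrite ge0_fin_numE ?(le_lt_trans bL) ?ltry// (le_trans _ b1).
move: b1 bL; rewrite -(fineK bfin) !lee_fin; set N := fine _ => N1 NL.
have N0 : (0 < N)%R by exact: lt_le_trans N1.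
exists (N * N)%R.
  by rewrite mulr_gt0//= -(sqr_sqrtr (ltW L0)) expr2 ler_pM// ltW.
have -> : ((N * N)^-1)%:E = (bmo_norm D b * bmo_norm D b)^-1.
  by rewrite -(fineK bfin) -/N -EFinM inver gt_eqF ?mulr_gt0.
have -> : sparse_operator [set` s] = paraproduct_composition D b b.
  by apply/funext => f; rewrite (paraproduct_haar_sum n_gt0 D_grid e0_cancel).
apply: ereal_sup_ubound; exists (b, b) => //=.
by split=> //; rewrite -(fineK bfin) eqe gt_eqF.
Qed.

Lemma carleson1 (L : R) Q : (1 <= L)%R -> carleson D L [set Q].
Proof.
move=> L1 P DP; have [QP|QP] := pselect (cube_set Q `<=` cube_set P).
  rewrite (_ : [set _ | _] = [set Q]); last first.
    by apply/seteqP; split => [C [//]|C -> /=].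
  rewrite esum_set1 ?measure_ge0//.
  apply: (@le_trans _ _ (lebesgue_tuple R n (cube_set P))).
    by apply: le_measure => //; rewrite inE; exact: measurable_cube_set.
  by rewrite leb_cube_set -EFinM lee_fin ler_peMl// ltW// volume_gt0.
rewrite (_ : [set _ | _] = set0); last by apply/seteqP; split => [C [-> /QP]|C].
by rewrite esum_set0 mule_ge0 ?lee_fin ?(le_trans _ L1).
Qed.

(** A supremum of nonnegative numbers, over a nonempty set: a single cube of the
    grid provides an admissible pair of symbols. *)
Lemma paraproduct_ratio_ge0 : 0 <= paraproduct_ratio.
Proof.
have [Q [DQ _ _]] := grid_cover D_grid 0 [tuple 0%R | i < n].
have [|||||c /andP[c0 _]] := @sparse_opnorm_finite 1 [:: Q].
- exact: ltr01.
- by move=> P; rewrite inE => /eqP ->; exact/mem_set.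
- by [].
- by rewrite set_cons1; exact: carleson1.
- by [].
apply: le_trans; rewrite mule_ge0 ?weighted_opnorm_ge0//.
by rewrite lee_fin invr_ge0 ltW.
Qed.

(** Subfamilies inherit the Carleson condition with the same constant, so the bound
    on finite ones is uniform. *)
Lemma sparse_opnorm_le (L : R) (S : set (cube R n)) : (0 < L)%R ->
  S `<=` D -> carleson D L S ->
  weighted_opnorm p w (sparse_operator S) <= paraproduct_ratio * L%:E.
Proof.
move=> L0 SD cS; have M0 := paraproduct_ratio_ge0.
have [code ci] := grid_countable D_grid.
have C0 : 0 <= paraproduct_ratio * L%:E by rewrite mule_ge0// lee_fin ltW.
apply: (weighted_opnorm_sparse_le p_gt1 (code := code) _ C0).
  by move=> P Q /set_mem SP /set_mem SQ; apply: ci; apply/mem_set/SD.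
move=> s us sS.
have [->|s0] := eqVneq s [::].
  apply: ge_ereal_sup => _ [f _ <-].
  rewrite (_ : sparse_operator _ f = cst 0).
    by rewrite Lnorm0// eqe gt_eqF// (lt_trans _ p_gt1).
  apply/funext => x; rewrite /sparse_operator /signed_sum set_nil.
  by rewrite !esum_set0 sube0.
have [|||||c /andP[c0 cL]] := @sparse_opnorm_finite L s => //.
- by move=> Q Qs; exact/mem_set/SD/sS.
- move=> Q DQ; apply: le_trans (cS Q DQ).
  apply: ereal_sup_le => _ [X [fX XN] <-]; exists X => //; split=> //.
  by move=> P /XN[Ps PQ]; split=> //; exact: sS.
rewrite lee_pdivrMr// => /le_trans; apply.
by apply: lee_wpmul2l => //; rewrite lee_fin.
Qed.

End sparse_le_paraproduct.

Local Open Scope ereal_scope.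

Theorem mainTheorem9 (R : realType) (n : nat) (n_gt0 : (0 < n)%N)
    (D : set (cube R n)) (D_grid : dyadic_grid D)
    (p : R) (p_gt1 : (1 < p)%R)
    (w : weight R n) (w_Ap : Ap D p w)
    (L : R) (L_gt1 : (1 < L)%R) :
  ereal_sup [set weighted_opnorm p w (sparse_operator S) / L%:E | S in
      [set S : set (cube R n) | [/\ S `<=` D, carleson D L S &
        ~ has_infinite_increasing_chain S]]]
  <= ereal_sup [set weighted_opnorm p w (paraproduct_composition D ab.1 ab.2)
                    / (bmo_norm D ab.1 * bmo_norm D ab.2) | ab in
      [set ab : (n.-tuple R -> R) * (n.-tuple R -> R) |
        [/\ bmo D ab.1, bmo D ab.2, bmo_norm D ab.1 != 0 &
          bmo_norm D ab.2 != 0]]].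
Proof.
apply: ge_ereal_sup => _ [S [SD cS _] <-].
have L0 : (0 < L)%R by exact: lt_trans L_gt1.
rewrite inver gt_eqF// lee_pdivrMr//.
exact: sparse_opnorm_le.
Qed.
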